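(* Let $\tilde A\in\mathbb{R}^{n\times n}$ be such that $i$ is an eigenvalue of $\tilde A$. Then there exists a permutation $\pi\in S_n$ such that $\tilde A P_\pi$ does not have the eigenvalue $i$.
   Context: $S_n$ is the group of permutations of $\{1,\dots,n\}$. For $\pi\in S_n$, $P_\pi\in\mathbb{R}^{n\times n}$ is the permutation matrix which permutes the columns of a matrix $\tilde A\in\mathbb{R}^{n\times n}$ with respect to $\pi$ when multiplied from the right (the $j$-th column of $\tilde AP_\pi$ is the $\pi^{-1}(j)$-th column of $\tilde A$). Eigenvalues are complex eigenvalues; $i$ is the imaginary unit. *)

(* Defs.v *)
From mathcomp Require Import all_boot all_order all_fingroup all_algebra.
From mathcomp Require Import reals.
From mathcomp Require Export complex.

Set Implicit Arguments.
Unset Strict Implicit.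
Unset Printing Implicit Defensive.

Import GRing.Theory.
Local Open Scope ring_scope.

(* The spectrum of a real matrix is taken over the complex numbers.  The
   library's eigenvalue is stated with row eigenvectors (v *m A = a *: v);
   a matrix and its transpose have the same eigenvalues. *)
Definition complex_eigenvalue (R : realType) (n : nat) (A : 'M[R]_n)
    (z : R[i]) : bool :=
  eigenvalue (map_mx (real_complex R) A) z.

(* perm_mx s has its 1 of row k in column s k, so multiplying by it on the
   right moves column s^-1 j to position j. *)
Lemma col_mul_perm_mx (R : realType) (n : nat) (A : 'M[R]_n) (s : 'S_n)
    (j : 'I_n) :
  col j (A *m perm_mx s) = col ((s^-1)%g j) A.
Proof. by rewrite -[s in LHS]invgK -col_permE; apply/colP => k; rewrite !mxE. Qed.

(* Main.v *)
Require Import Defs.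
From mathcomp Require Import all_boot all_order all_fingroup all_algebra.
From mathcomp Require Import reals.

(** Summing the characteristic matrices' determinants over all permutations
    and exchanging the Leibniz expansion with that sum gives
      sum_s det (A P_s + z I) = sum_s det (b_s 1^T + z I),
    where b_s is the column (A k (s k))_k.  The right-hand matrices are rank-one
    perturbations of z I, so the sum equals z^(n-1) (n! z + t), where t is a
    sum of entries of A.  For A real and z = -i this is nonzero, hence some
    A P_s does not have the eigenvalue i. *)

Import GRing.Theory Num.Theory.

Local Open Scope ring_scope.

Lemma sum_det_mul_perm_mx (R : comNzRingType) (n : nat) (A : 'M[R]_n) (z : R) :
  \sum_(s : 'S_n) \det (A *m perm_mx s + z%:M) =
  \sum_(s : 'S_n) \det ((\col_k A k (s k)) *m const_mx 1 + z%:M).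
Proof.
rewrite /determinant exchange_big [RHS]exchange_big /=.
apply: eq_bigr => t _.
(* For fixed [t], this substitution turns the factor [A k (s^-1 (t k))] into [A k (s k)], free of
   [t]. *)
rewrite (reindex_inj (h := fun s => s^-1 * t)%g) /=; last first.
  by move=> s1 s2 /mulIg /invg_inj.
apply: eq_bigr => s _; congr (_ * _); apply: eq_bigr => k _.
rewrite -[(s^-1 * t)%g]invgK -col_permE !mxE big_ord1 !mxE mulr1.
by rewrite invMg invgK permM permK.
Qed.

(** Two block eliminations on [M] compute [\det M] in two ways. The factor [z] on the left avoids
    division and the exponent [n - 1], so [n = 0] is covered. *)
Lemma det_rank1_add_scalar (R : comNzRingType) (n : nat) (b : 'cV[R]_n)
    (r : 'rV[R]_n) (z : R) :
  z * \det (b *m r + z%:M) = z ^+ n * (z + (r *m b) 0 0).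
Proof.
pose M := block_mx 1%:M (- r) b z%:M.
have detM : \det M = \det (b *m r + z%:M).
  have := congr1 (@determinant R _) (mulmx_block 1%:M (- r) b z%:M 1%:M r 0 1%:M).
  rewrite !mulmx0 !mulmx1 mul1mx subrr !addr0.
  by rewrite det_mulmx det_ublock det_lblock !det1 !mul1r mulr1.
have := congr1 (@determinant R _) (mulmx_block 1%:M (- r) b z%:M z%:M 0 (- b) 1%:M).
rewrite !mulmx0 !mulmx1 !mul1mx !add0r mulNmx !mulmxN opprK.
rewrite scalar_mxC subrr det_mulmx det_lblock det_ublock -/M detM.
rewrite det1 mulr1 !det_scalar expr1 det_mx11 !mxE eqxx mulr1n.
by rewrite mulrC => ->; rewrite mulrC.
Qed.

Lemma eigenvalue_det (F : fieldType) (n : nat) (A : 'M[F]_n) (a : F) :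
  eigenvalue A a = (\det (A + (- a)%:M) == 0).
Proof.
rewrite /eigenvalue /eigenspace kermx_eq0 row_free_unit unitmxE unitfE negbK.
by rewrite raddfN.
Qed.

Theorem corollary2p27 (R : realType) (n : nat) (A : 'M[R]_n)
    (hA : complex_eigenvalue A 'i%C) :
  exists s : 'S_n, ~~ complex_eigenvalue (A *m perm_mx s) 'i%C.
Proof.
apply/existsP; rewrite -negb_forall; apply/negP => /forallP eigA.
pose B := map_mx (real_complex R) A; pose z : R[i] := - 'i%C.
have z0 : z != 0 by rewrite oppr_eq0 eq_complex /= oner_eq0 andbF.
have : z * \sum_(s : 'S_n) \det (B *m perm_mx s + z%:M) = 0.
  rewrite big1 ?mulr0 // => s _; apply/eqP.
  by rewrite -eigenvalue_det -(map_perm_mx (real_complex R)) -map_mxM; exact: eigA.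
rewrite sum_det_mul_perm_mx mulr_sumr.
under eq_bigr => s _ do rewrite det_rank1_add_scalar.
rewrite -mulr_sumr => /eqP; rewrite mulf_eq0 expf_eq0 (negbTE z0) andbF /=.
rewrite big_split /= sumr_const card_Sn.
under eq_bigr => s _.
  rewrite mxE; under eq_bigr => k _ do rewrite !mxE mul1r.
  rewrite -rmorph_sum; over.
(* The entry sum is real, so only the [n!] copies of [z] contribute to the imaginary part, which is
   [- n!]. *)
rewrite -rmorph_sum /= => /eqP /(congr1 (@complex.Im R)).
rewrite raddfD raddfMn /= addr0 => /eqP.
by rewrite mulrn_eq0 oppr_eq0 oner_eq0 orbF eqn0Ngt fact_gt0.
Qed.
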